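(* Let $(T_n)_{n\ge 1}$ be a uniform random recursive tree and let $R_n$ be the Jordan rank of the root (vertex $1$) in $T_n$. Then $\mathbb{E}R_n=\Theta(\log n)$ as $n\to\infty$.
   Context: A uniform random recursive tree (URRT) is a random sequence of trees $(T_n)_{n\ge 1}$ with $V(T_n)=[n]=\{1,\ldots,n\}$: $T_1$ is the single vertex $1$ (the root), and $T_{n+1}$ is obtained from $T_n$ by adding vertex $n+1$ and an edge $\{i,n+1\}$, where $i$ is chosen uniformly at random from $[n]$, independently of the past. For a tree $T$ and vertices $u,v$ of $T$, $(T,v)_{u\downarrow}$ denotes the subtree containing all vertices $w$ such that the path from $w$ to $v$ contains $u$ (rooted at $u$), and $|\cdot|$ denotes its number of vertices. The Jordan centrality of $v\in V(T_n)$ is $\psi_{T_n}(v)=\max_{u\in V(T_n)\setminus\{v\}}|(T_n,v)_{u\downarrow}|$; smaller values correspond to more central vertices. Ranking: vertices are ordered from most to least central; vertices with equal centrality value are ordered in reverse order of insertion time (if $u,v$ have equal centrality, $u$ is ranked before $v$ iff $u>v$). This gives a permutation $\gamma_n$ of $[n]$, where $\gamma_n(v)\in\{1,\ldots,n\}$ is the position of $v$ in this order (position $1$ being most central). The rank of the root is $R_n=\gamma_n(1)$. *)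

(* Defs.v *)
From mathcomp Require Import all_boot all_order all_algebra finmap.
From mathcomp Require Import all_classical all_reals all_analysis.

Set Implicit Arguments.
Unset Strict Implicit.
Unset Printing Implicit Defensive.

Import Order.TTheory GRing.Theory Num.Theory.
Import numFieldNormedType.Exports.

Local Open Scope fset_scope.
Local Open Scope nat_scope.

Record graph := Graph {
  vertices : {fset nat};
  edges : {fset {fset nat}}
}.

Definition adj (g : graph) : rel nat := fun u v => [fset u; v] \in edges g.

(* [s] lists the vertices of a simple path from [w] to [v], both included. *)
Definition is_simple_path (g : graph) (w v : nat) (s : seq nat) : Prop :=
  exists p : seq nat,
    [/\ s = w :: p, path (adj g) w p, last w p = v & uniq s].

(* Since simple paths in a tree are unique, "the path from w to v
   contains u" is rendered as "some simple path from w to v contains u". *)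
Definition subtree (g : graph) (v u : nat) : {fset nat} :=
  [fset w in vertices g |
    `[< exists2 s, is_simple_path g w v s & u \in s >]].

(* The maximum is 0 when [v] is the only vertex. *)
Definition jordan_centrality (g : graph) (v : nat) : nat :=
  \max_(u <- vertices g | u != v) #|` subtree g v u|.

(* Reflexive version of "u is ranked before v", as required by [sort]. *)
Definition more_central (g : graph) : rel nat := fun u v =>
  (jordan_centrality g u < jordan_centrality g v) ||
  (jordan_centrality g u == jordan_centrality g v) && (v <= u).

Definition jordan_order (g : graph) : seq nat :=
  sort (more_central g) (vertices g).

Definition jordan_rank (g : graph) (v : nat) : nat :=
  (index v (jordan_order g)).+1.

Definition root_tree : graph := Graph [fset 1] fset0.

Definition attach (g : graph) (i v : nat) : graph :=
  Graph (v |` vertices g) ([fset i; v] |` edges g).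

Local Open Scope classical_set_scope.
Local Open Scope ring_scope.

(* The index [n] of [T] is the number of vertices, so [T 0] is unconstrained.
   [xi n] is the vertex to which [n.+1] is attached; the past is the list
   [T 1; ...; T n], which takes countably many values, so that arbitrary sets
   [B] of histories give events. *)
Definition uniform_random_recursive_tree (R : realType) (d : measure_display)
    (Omega : measurableType d) (P : probability Omega R)
    (T : nat -> Omega -> graph) : Prop :=
  (forall w, T 1%N w = root_tree) /\
  exists xi : nat -> {RV P >-> nat},
    forall n, (0 < n)%N ->
    let past w := [seq T k w | k <- iota 1 n] in
    [/\ forall w, (1 <= xi n w <= n)%N,
        forall w, T n.+1 w = attach (T n w) (xi n w) n.+1,
        forall i, (1 <= i <= n)%N -> P [set w | xi n w = i] = (n%:R^-1)%:E
      & forall (A : set nat) (B : set (seq graph)),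
          P ([set w | A (xi n w)] `&` [set w | B (past w)]) =
          (P [set w | A (xi n w)] * P [set w | B (past w)])%E].

(* Main.v *)
(** Let [|T_v|] be the number of descendants of [v] (itself included) when
    [T_n] is rooted at [1]. A vertex [v >= 2] is at least as central as the
    root iff [|T_v| + |T_c| >= n] for some [c >= 2], and then [c] can be chosen
    among the ancestors of [v] (or [c = v]). So the rank of the root is
    [1 + #{v | exists c, ...}].

    For [c] an ancestor of [v], the pair [(a, b) = (n - |T_c|, |T_v|)] evolves
    like a two-colour Polya urn (at random times), and the condition reads
    [a <= b]. Comparing its indicator with quadratic urn martingales bounds its
    probability, given the state [(a, 1)] when [v] is inserted, by
    [8 / ((a + 1) (a + 2))]; for [c = 2] and [a = 1] it is at least [1 / 6].
    As the expected number of [c >= 2] with [|T_c| = k] is [n / (k (k + 1))],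
    averaging over the state at the insertion of [v] shows that [v] is at least
    as central as the root with probability of order [1 / v], and the harmonic
    sum gives [log n]. *)

Require Import Defs.
From mathcomp Require Import all_boot all_order all_algebra finmap.
From mathcomp Require Import zify ring lra.
From mathcomp Require Import all_classical all_reals all_analysis.
From mathcomp Require Import measurable_realfun.

Set Implicit Arguments.
Unset Strict Implicit.
Unset Printing Implicit Defensive.

Import Order.TTheory GRing.Theory Num.Theory.
Import numFieldNormedType.Exports.

Local Open Scope nat_scope.

(** * Attachment histories and descendants *)

(* A history lists the attachment vertices, the latest first: the vertex
   attached to the head of [i :: h] is [(size h).+2]. *)
Fixpoint valid (h : seq nat) : bool :=
  if h is i :: h' then (1 <= i <= (size h').+1) && valid h' else true.

Fixpoint build (h : seq nat) : graph :=
  if h is i :: h' then attach (build h') i (size h').+2 else root_tree.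

Fixpoint parent (h : seq nat) (v : nat) : nat :=
  if h is i :: h' then if v == (size h').+2 then i else parent h' v else 0.

Fixpoint anc (h : seq nat) (u w : nat) : bool :=
  if h is i :: h' then
    if w == (size h').+2 then (u == w) || anc h' u i else anc h' u w
  else (u == 1) && (w == 1).

Definition subtree_size (h : seq nat) (u : nat) : nat :=
  \sum_(1 <= w < (size h).+2) anc h u w.

(** The latest vertex is a leaf, so it can only be an endpoint of a path, and the recursion peels it
    off there. This gives a computable stand-in for the existential path in [subtree]. *)
Fixpoint tree_path (h : seq nat) (w v : nat) : seq nat :=
  if h is i :: h' then
    if w == (size h').+2 then
      if v == (size h').+2 then [:: w] else w :: tree_path h' i v
    else if v == (size h').+2 then rcons (tree_path h' w i) v
    else tree_path h' w v
  else [:: 1].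

Lemma anc_bounds h u w : valid h -> anc h u w ->
  [/\ 1 <= u, u <= w & w <= (size h).+1].
Proof.
elim: h w => [|i h IH] w /=; first by move=> _ /andP[/eqP-> /eqP->].
case/andP=> /andP[i1 iS] vh.
case: eqP => [->|_] /=; last by case/(IH _ vh) => ? ? ?; split; lia.
by case/orP=> [/eqP->|/(IH _ vh)[? ? ?]]; split; lia.
Qed.

Lemma anc_refl h v : 1 <= v <= (size h).+1 -> anc h v v.
Proof.
elim: h => [|i h IH] /=; first lia.
move=> hv; case: eqP => [->|vx]; first by rewrite eqxx.
by apply: IH; lia.
Qed.

Lemma anc_trans h u v w : valid h -> anc h u v -> anc h v w -> anc h u w.
Proof.
move=> + + +; elim: h v w => [|i h IH] v w /=.
  by move=> _ /andP[-> _] /andP[_ ->].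
case/andP=> /andP[i1 iS] vh.
case: (eqVneq w) => [->|wx].
  move=> uv /orP[/eqP vx|vi]; first by move: uv; rewrite vx eqxx.
  have [_ _ ?] := anc_bounds vh vi.
  move: uv; case: (eqVneq v) => [|_ uv]; first by lia.
  by rewrite (IH _ _ vh uv vi) orbT.
case: (eqVneq v) => [->|_ uv vw]; last exact: IH uv vw.
by move=> _ /(anc_bounds vh)[]; lia.
Qed.

Lemma anc_total h u v w : valid h -> anc h u w -> anc h v w ->
  anc h u v || anc h v u.
Proof.
move=> + + +; elim: h w => [|i h IH] w /=.
  by move=> _ /andP[-> ->] /andP[-> _].
case/andP=> /andP[i1 iS] vh.
case: (eqVneq w) => [->|wx].
  case/orP=> [/eqP->|ui] /orP[/eqP->|vi]; rewrite ?eqxx //= ?vi ?ui ?orbT //.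
  have [_ ? ?] := anc_bounds vh ui; have [_ ? ?] := anc_bounds vh vi.
  do 2!(case: eqP => ?; first by lia).
  exact: IH ui vi.
move=> uw vw.
have [_ ? ?] := anc_bounds vh uw; have [_ ? ?] := anc_bounds vh vw.
do 2!(case: eqP => ?; first by lia).
exact: IH uw vw.
Qed.

Lemma subtree_size_cons i h u : u <= (size h).+1 ->
  subtree_size (i :: h) u = subtree_size h u + anc h u i.
Proof.
move=> uS; rewrite /subtree_size /= big_nat_recr //= eqxx.
rewrite (ltn_eqF (_ : u < _)) //; congr (_ + _).
by apply: eq_big_nat => w wS; rewrite ltn_eqF //; lia.
Qed.

Lemma subtree_size_new i h : valid (i :: h) ->
  subtree_size (i :: h) (size h).+2 = 1.
Proof.
move=> vh; rewrite /subtree_size big_nat_recr //= eqxx /=.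
rewrite big_nat big1 // => w wS.
rewrite ltn_eqF; last lia.
move: vh => /= /andP[_ vh].
by apply/eqP; rewrite eqb0; apply/negP => /(anc_bounds vh)[]; lia.
Qed.

Lemma subtree_size_le h u v : valid h -> anc h u v ->
  subtree_size h v <= subtree_size h u.
Proof.
move=> vh uv; apply: leq_sum => w _.
by case: (boolP (anc h v w)) => // vw; rewrite (anc_trans vh uv vw).
Qed.

Lemma subtree_size_gt0 h v : 1 <= v <= (size h).+1 -> 0 < subtree_size h v.
Proof.
move=> hv; rewrite /subtree_size (@big_cat_nat _ _ _ v) //=; [|lia|lia].
rewrite [X in _ + X]big_ltn; last lia.
by rewrite anc_refl // addnCA.
Qed.

(** Labels increase away from the root, so every descendant of [v] is numbered at least [v]. *)
Lemma subtree_size_bound h v : valid h -> 1 <= v <= (size h).+1 ->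
  subtree_size h v + v <= (size h).+2.
Proof.
move=> vh hv; rewrite /subtree_size.
rewrite (@big_cat_nat _ _ _ v) //=; [|lia|lia].
rewrite big_nat big1 => [|w wS]; last first.
  apply/eqP; rewrite eqb0; apply/negP => /(anc_bounds vh)[]; lia.
rewrite add0n addnC -leq_subRL; last lia.
rewrite -[X in _ <= X]muln1 -sum_nat_const_nat.
by apply: leq_sum => w _; case: anc.
Qed.

(** Ancestors of a vertex form a chain, so incomparable vertices have disjoint subtrees; neither
    contains vertex 1, which improves the bound from [(size h).+1] to [size h]. *)
Lemma disjoint_subtree_size h u v : valid h -> 2 <= u -> 2 <= v ->
  ~~ anc h u v -> ~~ anc h v u ->
  subtree_size h u + subtree_size h v <= size h.
Proof.
move=> vh u2 v2 nuv nvu; rewrite /subtree_size -big_split /=.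
rewrite big_ltn //; set x := anc h u 1 + _.
have -> : x = 0.
  rewrite /x; case: (boolP (anc h u 1)) => [/(anc_bounds vh)[]|_]; first lia.
  by case: (boolP (anc h v 1)) => [/(anc_bounds vh)[]|_] //; lia.
rewrite add0n; apply: (@leq_trans (\sum_(2 <= w < (size h).+2) 1)); last first.
  by rewrite sum_nat_const_nat; lia.
apply: leq_sum => w _.
case: (boolP (anc h u w)) => uw; case: (boolP (anc h v w)) => vw //.
by have := anc_total vh uw vw; rewrite (negbTE nuv) (negbTE nvu).
Qed.

(* If the pair [(v, c)] is not nested with [c] above [v], then either [c] is
   below [v] and [c] can be replaced by [v], or both subtrees are disjoint and
   avoid the root. *)
Lemma large_pair_nested h c v : valid h -> 2 <= c -> 2 <= v ->
  1 <= v <= (size h).+1 ->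
  size h < subtree_size h v + subtree_size h c ->
  exists2 c', 2 <= c' <= v &
    anc h c' v && (size h < subtree_size h v + subtree_size h c').
Proof.
move=> vh c2 v2 hv big; case: (boolP (anc h c v)) => [cv|ncv].
  by have [? ? ?] := anc_bounds vh cv; exists c; rewrite ?c2 ?cv.
exists v; first lia.
rewrite anc_refl //=; case: (boolP (anc h v c)) => [vc|nvc].
  by have := subtree_size_le vh vc; lia.
by have := disjoint_subtree_size vh v2 c2 nvc ncv; lia.
Qed.

(** * Paths *)

Lemma mem_vertices_build h v :
  (v \in vertices (build h)) = (1 <= v <= (size h).+1).
Proof.
elim: h => [|i h IH] /=; first by rewrite in_fset1; lia.
by rewrite in_fset1U IH; lia.
Qed.

Lemma eq_fset2 (a b i x : nat) :
  ([fset a; b] == [fset i; x])%fset =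
  (a == i) && (b == x) || (a == x) && (b == i).
Proof.
apply/eqP/idP => [/fsetP E|].
  have := E a; have := E b; have := E i; have := E x.
  rewrite !in_fset2 !eqxx !orbT /=.
  by rewrite !(eq_sym i) !(eq_sym x); do 4!case: eqP => //= ?; subst.
by case/orP=> /andP[/eqP-> /eqP->] //; rewrite fsetUC.
Qed.

Lemma adj_attach g i x a b : adj (attach g i x) a b =
  [|| (a == i) && (b == x), (a == x) && (b == i) | adj g a b].
Proof. by rewrite /adj /= in_fset1U eq_fset2 orbA. Qed.

Lemma adj_build_bounds h a b : valid h -> adj (build h) a b ->
  (1 <= a <= (size h).+1) && (1 <= b <= (size h).+1).
Proof.
elim: h => [|i h IH] /=; first by rewrite /adj in_fset0.
case/andP=> hi vh; rewrite adj_attach.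
by case/or3P=> [/andP[/eqP-> /eqP->]|/andP[/eqP-> /eqP->]|/(IH vh)]; lia.
Qed.

Lemma tree_path_bounds h w v x : valid h -> 1 <= w <= (size h).+1 ->
  1 <= v <= (size h).+1 -> x \in tree_path h w v -> 1 <= x <= (size h).+1.
Proof.
elim: h w v => [|i h IH] w v /=; first by rewrite inE => _ _ _ /eqP->.
case/andP=> hi vh hw hv.
have [ew|wx] := eqVneq w (size h).+2; have [ev|vx] := eqVneq v (size h).+2;
  rewrite ?ew ?ev ?mem_rcons ?inE.
- by move/eqP->; lia.
- by case/orP=> [/eqP->|/IH]; lia.
- by case/orP=> [/eqP->|/IH]; lia.
- by move/IH; lia.
Qed.

(* The new leaf has a single neighbour, so a simple path between old vertices
   cannot go through it. *)
Lemma path_attach_leaf h i w p : valid (i :: h) -> w != (size h).+2 ->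
  uniq (w :: p) -> last w p != (size h).+2 ->
  path (adj (build (i :: h))) w p -> path (adj (build h)) w p.
Proof.
set x := (size h).+2 => /= /andP[hi vh].
have ax a : adj (attach (build h) i x) a x -> a = i.
  rewrite adj_attach => /or3P[/andP[/eqP->]//|/andP[/eqP-> /eqP]//|].
  by move/(adj_build_bounds vh); rewrite /x; lia.
have xa a : adj (attach (build h) i x) x a -> a = i.
  rewrite adj_attach => /or3P[/andP[/eqP<- /eqP->]//|/andP[_ /eqP->]//|].
  by move/(adj_build_bounds vh); rewrite /x; lia.
elim: p w => //= y p IH w wx /and3P[wyp yp up] lx /andP[wy yP].
have yx : y != x.
  apply/eqP => yx; move: lx yP wyp wy; rewrite yx.
  case: p {IH yp up} => [|z p] /=; first by rewrite eqxx.
  by move=> _ /andP[/xa -> _]; rewrite !inE => /norP[_ /norP[wi _]] /ax; move/eqP: wi.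
rewrite IH ?yp // andbT.
by move: wy; rewrite adj_attach (negbTE wx) (negbTE yx) andbF.
Qed.

Lemma adj_sym g : symmetric (adj g).
Proof. by move=> a b; rewrite /adj fsetUC. Qed.

(** Induction on the latest leaf: at an endpoint, its only neighbour [i] must come next; otherwise
    [path_attach_leaf] puts the whole path in the smaller tree. *)
Lemma tree_path_unique h w v s : valid h -> 1 <= w <= (size h).+1 ->
  1 <= v <= (size h).+1 -> is_simple_path (build h) w v s ->
  s = tree_path h w v.
Proof.
elim: h w v s => [|i h IH] w v s.
  move=> _ /= hw hv [[|y p] [-> pp lp up]]; first by rewrite (_ : w = 1) //; lia.
  by have /andP[] : adj root_tree w y && path (adj root_tree) y p := pp; rewrite {1}/adj in_fset0.
move=> vih; have /= /andP[hi vh] := vih => hw hv [p [-> pp lp up]].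
have ax a : adj (build (i :: h)) a (size h).+2 -> a = i.
  rewrite adj_attach => /or3P[/andP[/eqP->]//|/andP[/eqP-> /eqP]//|].
  by move/(adj_build_bounds vh); lia.
have [ew|wx] := eqVneq w (size h).+2.
  have [ev|vx] := eqVneq v (size h).+2.
    case/lastP: p lp up {pp} => // p y; rewrite last_rcons => ->.
    by rewrite ev ew /= mem_rcons mem_head.
  case: p lp up pp => [/=|y p] lp up pp; first by case/eqP: vx; rewrite -lp.
  move: pp => /= /andP[wy pp]; have yi : y = i by move: wy; rewrite ew adj_sym => /ax.
  congr (_ :: _); apply: IH => //; [lia|].
  rewrite yi in pp lp up *; exists p; split=> //.
    apply: path_attach_leaf pp => //; [lia|by case/andP: up|].
    by move: lp => /= ->.
  by case/andP: up.
have [ev|vx] := eqVneq v (size h).+2.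
  case/lastP: p lp up pp => [/=|p y]; first by move=> wv; rewrite wv ev eqxx in wx.
  rewrite last_rcons => ->; rewrite -rcons_cons rcons_uniq rcons_path.
  move=> /andP[vp up] /andP[pp lv]; have lpi : last w p = i by move: lv; rewrite ev => /ax.
  congr rcons; apply: IH => //; [lia|].
  exists p; split=> //; apply: path_attach_leaf pp => //.
  by rewrite lpi; lia.
apply: IH => //; [lia|lia|].
by exists p; split=> //; apply: path_attach_leaf pp => //; rewrite lp.
Qed.

Lemma tree_path_simple h w v : valid h -> 1 <= w <= (size h).+1 ->
  1 <= v <= (size h).+1 -> is_simple_path (build h) w v (tree_path h w v).
Proof.
elim: h w v => [|i h IH] w v.
  by move=> _ /= hw hv; exists [::]; split=> //=; [congr (_ :: _); lia|lia].
move=> /= /andP[hi vh] hw hv.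
have sub a b : adj (build h) a b -> adj (attach (build h) i (size h).+2) a b.
  by rewrite adj_attach => ->; rewrite !orbT.
have notin a b : 1 <= a <= (size h).+1 -> 1 <= b <= (size h).+1 ->
    (size h).+2 \notin tree_path h a b.
  by move=> ha hb; apply/negP => /(tree_path_bounds vh ha hb); lia.
have [ew|wx] := eqVneq w (size h).+2; have [ev|vx] := eqVneq v (size h).+2;
  rewrite ?ew ?ev.
- by exists [::]; split.
- have [p [E pp lp up]] := IH i v vh hi ltac:(lia).
  exists (i :: p); split=> //; first by rewrite E.
  + by rewrite /= adj_attach !eqxx orbT /=; apply: sub_path pp.
  + by rewrite cons_uniq up notin //; lia.
- have [p [E pp lp up]] := IH w i vh ltac:(lia) hi.
  exists (rcons p (size h).+2); split.
  + by rewrite E.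
  + rewrite rcons_path (sub_path sub pp) lp.
    by rewrite adj_attach !eqxx.
  + by rewrite last_rcons.
  + by rewrite rcons_uniq up notin //; lia.
- have [p [E pp lp up]] := IH w v vh ltac:(lia) ltac:(lia).
  by exists p; split=> //; apply: sub_path pp.
Qed.

Lemma mem_subtree h v u w : valid h -> 1 <= v <= (size h).+1 ->
  (w \in subtree (build h) v u) =
  (1 <= w <= (size h).+1) && (u \in tree_path h w v).
Proof.
move=> vh hv; rewrite /subtree !inE /= mem_vertices_build.
case: (boolP (1 <= w <= _)) => //= hw; apply/asboolP/idP.
  by case=> s /(tree_path_unique vh hw hv) ->.
by move=> us; exists (tree_path h w v) => //; apply: tree_path_simple.
Qed.

(** When [v] lies outside the subtree of [u], rooting at [v] instead of 1 leaves that subtree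
    unchanged, since it is joined to the rest only through [u]. *)
Lemma tree_path_notanc h u v w : valid h -> 1 <= w <= (size h).+1 ->
  1 <= v <= (size h).+1 -> ~~ anc h u v -> (u \in tree_path h w v) = anc h u w.
Proof.
elim: h u v w => [|i h IH] u v w.
  rewrite /= inE => _ hw hv; have -> : v = 1 by lia.
  by (have -> : w = 1 by lia); rewrite eqxx andbT.
move=> /= /andP[hi vh] hw hv.
have [ew|wx] := eqVneq w (size h).+2; have [ev|vx] := eqVneq v (size h).+2;
  rewrite ?ew ?ev ?mem_rcons ?inE.
- by case/norP=> /negbTE-> /negbTE->.
- by move=> nuv; rewrite IH //; lia.
- by case/norP=> /negbTE-> ni /=; rewrite IH //; lia.
- by move=> nuv; rewrite IH //; lia.
Qed.

Lemma tree_path_in_subtree h u v w : valid h -> anc h v w ->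
  u \in tree_path h w v -> anc h v u.
Proof.
elim: h u v w => [|i h IH] u v w.
  by move=> _ /= /andP[/eqP-> _]; rewrite inE => /eqP->.
move=> /= /andP[hi vh].
have new : ~~ anc h (size h).+2 w /\ ~~ anc h (size h).+2 i.
  by split; apply/negP => /(anc_bounds vh)[]; lia.
have [ew|wx] := eqVneq w (size h).+2; have [ev|vx] := eqVneq v (size h).+2;
  rewrite ?ew ?ev ?mem_rcons ?inE.
- by move=> _ /eqP->; rewrite !eqxx.
- rewrite (negbTE vx) /= => vi /orP[/eqP->|ui]; first by rewrite eqxx vi orbT.
  have vu := IH _ _ _ vh vi ui; have [_ _ ?] := anc_bounds vh vu.
  by case: eqP => // ?; lia.
- by rewrite (negbTE new.1).
- move=> vw uw; have vu := IH _ _ _ vh vw uw.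
  by have [_ _ ?] := anc_bounds vh vu; case: eqP => // ?; lia.
Qed.

Lemma parent_bounds h v : valid h -> 1 < v <= (size h).+1 -> 1 <= parent h v < v.
Proof.
elim: h => [|i h IH] /=; first lia.
by case/andP=> hi vh hv; case: eqP => ?; [|have := IH vh]; lia.
Qed.

Lemma tree_path_parent h v w : valid h -> 1 <= w <= (size h).+1 ->
  1 < v <= (size h).+1 -> ~~ anc h v w -> parent h v \in tree_path h w v.
Proof.
elim: h v w => [|i h IH] v w; first by move=> /=; lia.
move=> /= /andP[hi vh] hw hv.
have [ew|wx] := eqVneq w (size h).+2; have [ev|vx] := eqVneq v (size h).+2;
  rewrite ?ew ?ev ?mem_rcons ?inE ?eqxx //.
- by rewrite (negbTE vx) /= => nvi; rewrite IH ?orbT //; lia.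
- move=> _; have hw' : 1 <= w <= (size h).+1 by lia.
  have [p [-> _ lp _]] := tree_path_simple vh hw' hi.
  by apply/orP; right; rewrite -[X in X \in _]lp mem_last.
- by move=> nvw; apply: IH => //; lia.
Qed.

(** * Centrality and rank *)

Lemma card_fset_sum (A : {fset nat}) m n (P : pred nat) :
  (forall w, (w \in A) = (m <= w < n) && P w) ->
  #|` A| = \sum_(m <= w < n) P w.
Proof.
move=> AP.
have -> : \sum_(m <= w < n) P w = count P (index_iota m n).
  by rewrite -sum1_count [RHS]big_mkcond; apply: eq_bigr => w _; case: (P w).
rewrite -size_filter; apply: perm_size; apply: uniq_perm => [||w].
- exact: fset_uniq.
- exact/filter_uniq/iota_uniq.
- by rewrite AP mem_filter mem_index_iota andbC.
Qed.

Lemma card_subtree h v u : valid h -> 1 <= v <= (size h).+1 ->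
  #|` subtree (build h) v u| =
  \sum_(1 <= w < (size h).+2) (u \in tree_path h w v).
Proof. by move=> vh hv; apply: card_fset_sum => w; rewrite mem_subtree. Qed.

Lemma card_subtree_notanc h v u : valid h -> 1 <= v <= (size h).+1 ->
  ~~ anc h u v -> #|` subtree (build h) v u| = subtree_size h u.
Proof.
move=> vh hv nuv; rewrite card_subtree //.
by apply: eq_big_nat => w hw; rewrite tree_path_notanc.
Qed.

(** Seen from [v], the branch through a proper ancestor contains no descendant of [v], hence has at
    most [n - |T_v|] vertices. By [card_subtree_parent] the branch through the parent attains
    this. *)
Lemma card_subtree_anc h v u : valid h -> 1 <= v <= (size h).+1 -> u != v ->
  anc h u v -> #|` subtree (build h) v u| + subtree_size h v <= (size h).+1.
Proof.
move=> vh hv uv auv; rewrite card_subtree // -big_split /=.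
apply: (@leq_trans (\sum_(1 <= w < (size h).+2) 1)); last first.
  by rewrite sum_nat_const_nat; lia.
apply: leq_sum => w _.
case: (boolP (anc h v w)) => [vw|_]; last by rewrite addn0; case: (_ \in _).
case: (boolP (u \in _)) => [/(tree_path_in_subtree vh vw) vu|//].
by have [_ ? _] := anc_bounds vh auv; have [_ ? _] := anc_bounds vh vu; lia.
Qed.

Lemma card_subtree_parent h v : valid h -> 1 < v <= (size h).+1 ->
  size h < #|` subtree (build h) v (parent h v)| + subtree_size h v.
Proof.
move=> vh hv; rewrite card_subtree //; last lia.
rewrite -big_split /= -[X in X <= _]muln1 -[X in X * _](subn1 (size h).+2).
rewrite -sum_nat_const_nat big_nat [X in _ <= X]big_nat; apply: leq_sum => w hw.
by case: (boolP (anc h v w)) => [|/(tree_path_parent vh hw hv) ->]; rewrite ?addn1.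
Qed.

Lemma jordan_centrality_leP h v k :
  reflect (forall u, 1 <= u <= (size h).+1 -> u != v ->
             #|` subtree (build h) v u| <= k)
          (jordan_centrality (build h) v <= k).
Proof.
rewrite /jordan_centrality; apply: (iffP idP) => [/bigmax_leqP_seq H u hu|H].
  by apply: H; rewrite mem_vertices_build.
by apply/bigmax_leqP_seq => u; rewrite mem_vertices_build; apply: H.
Qed.

Lemma anc_root h v : valid h -> 1 <= v <= (size h).+1 -> anc h 1 v.
Proof.
elim: h v => [|i h IH] v /=; first lia.
case/andP=> hi vh hv; case: eqP => ?; first by rewrite IH ?orbT.
by apply: IH => //; lia.
Qed.

(** With [n = (size h).+1], the list is that of the non-root vertices and the strict inequality
    reads [n <= |T_v| + |T_c|]. *)
Definition as_central_as_root (h : seq nat) (v : nat) : bool :=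
  has (fun c => size h < subtree_size h v + subtree_size h c) (iota 2 (size h)).

(** The branches at [v] are those through ancestors, of maximal size [n - |T_v|], and subtrees [T_u]
    with [u >= 2]. The latter never exceed the centrality of the root, which is the maximum of all
    [|T_c|] with [c >= 2]; so only [n - |T_v|] has to be compared with it. *)
Lemma jordan_centrality_le_root h v : valid h -> 1 < v <= (size h).+1 ->
  (jordan_centrality (build h) v <= jordan_centrality (build h) 1) =
  as_central_as_root h v.
Proof.
move=> vh hv.
have root u : 2 <= u -> ~~ anc h u 1.
  by move=> u2; apply/negP => /(anc_bounds vh)[]; lia.
apply/idP/hasP => [le1|[c cS vc]].
  have : size h - subtree_size h v < jordan_centrality (build h) 1.
    apply: leq_trans le1.
    have hp := parent_bounds vh hv.
    have /jordan_centrality_leP := leqnn (jordan_centrality (build h) v).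
    move=> /(_ (parent h v) ltac:(lia) ltac:(lia)).
    have := card_subtree_parent vh hv.
    have /= := @subtree_size_bound h v vh ltac:(lia); lia.
  rewrite ltnNge => /jordan_centrality_leP lt.
  apply: contrapT => no; apply: lt => u hu u1.
  rewrite card_subtree_notanc ?root //; try lia.
  rewrite leqNgt; apply/negP => big; apply: no; exists u; first by rewrite mem_iota; lia.
  lia.
apply/jordan_centrality_leP => u hu uv.
move: cS; rewrite mem_iota => cS.
have le1 w : 2 <= w <= (size h).+1 ->
    subtree_size h w <= jordan_centrality (build h) 1.
  move=> hw; rewrite -(@card_subtree_notanc h 1) ?root //; try lia.
  have /jordan_centrality_leP := leqnn (jordan_centrality (build h) 1).
  by apply; lia.
case: (boolP (anc h u v)) => auv.
  have := @card_subtree_anc h v u vh ltac:(lia) uv auv.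
  have := le1 c ltac:(lia); lia.
rewrite card_subtree_notanc //; try lia.
apply: le1; suff : u != 1 by lia.
apply: contra auv => /eqP->; apply: anc_root => //; lia.
Qed.

(** Split the sorted list at [x]: all that precedes is related to [x], and by antisymmetry nothing
    that follows is. *)
Lemma index_sort (r : rel nat) (s : seq nat) (x : nat) :
  total r -> transitive r -> antisymmetric r -> uniq s -> x \in s ->
  index x (sort r s) = \sum_(y <- s | y != x) r y x.
Proof.
move=> tot tr asym us xs.
have ss := sort_sorted tot s.
rewrite -(perm_big _ (permEl (perm_sort r s))) /=.
have {us} : uniq (sort r s) by rewrite sort_uniq.
have {xs} : x \in sort r s by rewrite mem_sort.
move: ss => + /splitPr xs; case: xs => s1 s2.
rewrite (sorted_pairwise tr) pairwise_cat pairwise_cons.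
case/and3P=> /allrelP le12 _ /andP[/allP le2 _].
rewrite cat_uniq /= negb_or => /and3P[_ /andP[x1 _] /andP[x2 _]].
rewrite index_cat (negbTE x1) /= eqxx addn0 big_cat big_cons /= eqxx /=.
rewrite [X in _ = _ + X]big_seq_cond [X in _ = _ + X]big1 => [|y /andP[y2 yx]].
  rewrite addn0 -sum1_size big_seq [RHS]big_seq_cond.
  apply: eq_big => y; first by case: eqP => [->|]; rewrite ?(negbTE x1) ?andbT.
  by move=> y1; rewrite le12 // mem_head.
apply/eqP; rewrite eqb0; apply: contra yx => ryx.
by apply/eqP/asym; rewrite ryx le2.
Qed.

Lemma more_central_total g : total (more_central g).
Proof. by move=> u v; rewrite /more_central; case: ltngtP => //= _; lia. Qed.

Lemma more_central_trans g : transitive (more_central g).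
Proof. by move=> v u w; rewrite /more_central; lia. Qed.

Lemma more_central_asym g : antisymmetric (more_central g).
Proof. by move=> u v; rewrite /more_central; lia. Qed.

(** The root has the smallest label and loses every tie, so [v] precedes it as soon as its
    centrality is at most that of the root. *)
Lemma jordan_rank_root h : valid h ->
  jordan_rank (build h) 1 = (\sum_(2 <= v < (size h).+2) as_central_as_root h v).+1.
Proof.
move=> vh; rewrite /jordan_rank index_sort; first congr S.
- rewrite (perm_big (index_iota 1 (size h).+2)) /=; last first.
    apply: uniq_perm; [exact: fset_uniq|exact: iota_uniq|].
    by move=> v; rewrite mem_vertices_build mem_index_iota.
  rewrite big_ltn_cond //= [LHS]big_nat_cond [RHS]big_nat; apply: eq_big => v.
    by lia.
  move=> /andP[hv _]; rewrite -jordan_centrality_le_root //.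
  by rewrite /more_central; lia.
- exact: more_central_total.
- exact: more_central_trans.
- exact: more_central_asym.
- exact: fset_uniq.
- by rewrite mem_vertices_build.
Qed.

Local Open Scope classical_set_scope.
Local Open Scope ring_scope.

(** * Averages over histories *)

Section Average.
Variable R : realFieldType.
Implicit Types (F G : seq nat -> R) (h : seq nat).

(* The mean of [F] over the uniform recursive trees with [n.+1] vertices. *)
Fixpoint avg (n : nat) (F : seq nat -> R) : R :=
  if n is m.+1 then
    avg m (fun h => m.+1%:R^-1 * \sum_(1 <= i < m.+2) F (i :: h))
  else F [::].

Lemma avg_le n F G :
  (forall h, valid h -> size h = n -> F h <= G h) -> avg n F <= avg n G.
Proof.
elim: n F G => [|n IH] F G FG /=; first exact: FG.
apply: IH => h vh sh; rewrite ler_pM2l ?invr_gt0 ?ltr0n //.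
rewrite big_nat [leRHS]big_nat; apply: ler_sum => i hi.
by apply: FG; rewrite /= ?sh // vh andbT; lia.
Qed.

Lemma eq_avg n F G :
  (forall h, valid h -> size h = n -> F h = G h) -> avg n F = avg n G.
Proof. by move=> FG; apply/eqP; rewrite eq_le !avg_le // => h vh /(FG h vh)->. Qed.

Lemma avg_cst n (x : R) : avg n (fun=> x) = x.
Proof.
elim: n => //= n {2}<-; apply: eq_avg => h _ _.
by rewrite sumr_const_nat subSS subn0 -[x *+ _]mulr_natl mulKf // pnatr_eq0.
Qed.

Lemma avgD n F G : avg n (fun h => F h + G h) = avg n F + avg n G.
Proof.
elim: n F G => //= n IH F G; rewrite -IH; apply: eq_avg => h _ _.
by rewrite big_split mulrDr.
Qed.

Lemma avgZ n (x : R) F : avg n (fun h => x * F h) = x * avg n F.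
Proof.
elim: n F => //= n IH F; rewrite -IH; apply: eq_avg => h _ _.
by rewrite -mulr_sumr mulrCA.
Qed.

Lemma avg_sum n (I : Type) (s : seq I) (F : I -> seq nat -> R) :
  avg n (fun h => \sum_(j <- s) F j h) = \sum_(j <- s) avg n (F j).
Proof.
elim: s => [|j s IH].
  by rewrite big_nil -[RHS](avg_cst n); apply: eq_avg => h _ _; rewrite big_nil.
by rewrite big_cons -IH -avgD; apply: eq_avg => h _ _; rewrite big_cons.
Qed.

Lemma sum_anc2 h c v (x y z : R) : valid h -> anc h c v ->
  \sum_(1 <= i < (size h).+2)
     (if anc h v i then x else if anc h c i then y else z) =
  (subtree_size h v)%:R * x +
  ((subtree_size h c)%:R - (subtree_size h v)%:R) * y +
  ((size h).+1%:R - (subtree_size h c)%:R) * z.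
Proof.
move=> vh cv; rewrite (eq_bigr (fun i => (anc h v i)%:R * (x - y) +
  ((anc h c i)%:R * (y - z) + z))) => [|i _]; last first.
  case: (boolP (anc h v i)) => [vi|_]; first by rewrite (anc_trans vh cv vi) /=; ring.
  by case: anc => /=; ring.
rewrite !big_split /= -!mulr_suml sumr_const_nat subSS subn0 -[z *+ _]mulr_natl.
by rewrite -!natr_sum /subtree_size; ring.
Qed.

Lemma sum_anc h c (y z : R) : \sum_(1 <= i < (size h).+2)
     (if anc h c i then y else z) =
  (subtree_size h c)%:R * y + ((size h).+1%:R - (subtree_size h c)%:R) * z.
Proof.
rewrite (eq_bigr (fun i => (anc h c i)%:R * (y - z) + z)) => [|i _]; last first.
  by case: anc => /=; ring.
rewrite !big_split /= -!mulr_suml sumr_const_nat subSS subn0 -[z *+ _]mulr_natl.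
by rewrite -!natr_sum /subtree_size; ring.
Qed.

(* [phi] is evaluated at the numbers of vertices outside the subtree of [c]
   and inside the subtree of [v]. These two numbers evolve like the content of
   a two-colour Polya urn that is updated at random times. *)
Definition urn (phi : nat -> nat -> R) (c v : nat) (h : seq nat) : R :=
  if anc h c v then phi ((size h).+1 - subtree_size h c)%N (subtree_size h v)
  else 0.

(** The supermartingale inequality for one Polya draw, multiplied by the number [a + b] of balls. *)
Definition urn_superharmonic (phi : nat -> nat -> R) : Prop :=
  forall a b, (0 < a)%N -> (0 < b)%N ->
    a%:R * phi a.+1 b + b%:R * phi a b.+1 <= (a + b)%:R * phi a b.

Lemma subtree_size_ltn h c : valid h -> (2 <= c <= (size h).+1)%N ->
  (subtree_size h c <= size h)%N.
Proof. by move=> vh hc; have /= := @subtree_size_bound h c vh ltac:(lia); lia. Qed.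

(** A new vertex below [v] adds a ball of the second colour and one outside the subtree of [c] a
    ball of the first; one below [c] but not below [v] changes nothing. So each attachment is a
    Polya draw or an idle step. *)
Lemma avg_urn_le phi c v n k : urn_superharmonic phi ->
  (2 <= c)%N -> (c <= v <= n.+1)%N ->
  avg (k + n) (urn phi c v) <= avg n (urn phi c v).
Proof.
move=> super c2 cv; elim: k => // k /(le_trans _); apply.
rewrite addSn /=; apply: avg_le => h vh sh.
rewrite ler_pdivrMl ?ltr0n // -sh; rewrite /urn /=.
have /= [hv hc] : (v <= (size h).+1 /\ c <= (size h).+1)%N by lia.
case: (boolP (anc h c v)) => acv; last first.
  rewrite mulr0 big1_seq // => i _; rewrite ltn_eqF ?(negbTE acv) //; lia.
set s := subtree_size h c; set b := subtree_size h v.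
have s_le : (s <= size h)%N by apply: subtree_size_ltn => //; lia.
have b_le : (b <= s)%N by apply: subtree_size_le.
have b_gt0 : (0 < b)%N by apply: subtree_size_gt0; lia.
rewrite (eq_big_nat _ _ (F2 := fun i => if anc h v i
    then phi ((size h).+1 - s)%N b.+1 else if anc h c i
    then phi ((size h).+1 - s)%N b else phi ((size h).+1 - s).+1 b)); last first.
  move=> i hi; rewrite ltn_eqF ?acv; last lia.
  rewrite (@subtree_size_cons i h c) // (@subtree_size_cons i h v) // -/s -/b.
  case: (boolP (anc h v i)) => [vi|_].
    by rewrite (anc_trans vh acv vi) !addn1 subSS.
  rewrite addn0; case: (anc h c i); first by rewrite addn1 subSS.
  by rewrite addn0 subSn //; lia.
rewrite sum_anc2 // -/s -/b.
have := super ((size h).+1 - s)%N b ltac:(lia) b_gt0.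
rewrite natrD natrB; last lia.
set p := phi _ _; set q := phi _ _; set r := phi _ _; nra.
Qed.

(** The new vertex falls below [c] with probability [|T_c| / n.+1]. The subtree of [c] then grows
    with the tree, so the first count keeps its value and the second starts at 1. *)
Lemma avg_urn_birth phi c n : (2 <= c <= n.+1)%N ->
  avg n.+1 (urn phi c n.+2) = n.+1%:R^-1 *
  avg n (fun h => (subtree_size h c)%:R * phi (n.+1 - subtree_size h c)%N 1%N).
Proof.
move=> hc /=; rewrite -avgZ; apply: eq_avg => h vh sh; congr (_ * _).
rewrite -sh (eq_big_nat _ _ (F2 := fun i => if anc h c i
    then phi ((size h).+1 - subtree_size h c)%N 1%N else 0)); last first.
  move=> i hi; rewrite /urn /= eqxx ltn_eqF /=; last lia.
  case: (boolP (anc h c i)) => // ci.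
  rewrite subtree_size_cons; last lia.
  rewrite subtree_size_new; last by rewrite /= vh andbT; lia.
  by rewrite ci addn1 subSS.
by rewrite sum_anc mulr0 addr0.
Qed.

Lemma avg_urn_birth_refl phi n :
  avg n.+1 (urn phi n.+2 n.+2) = phi n.+1 1%N.
Proof.
rewrite -[RHS](avg_cst n.+1); apply: eq_avg => -[//|i h] vh [sh].
rewrite /urn -sh subtree_size_new // anc_refl /=; last by rewrite leqnn.
by rewrite subn1.
Qed.

(** The weight of [phi k] is the expected number of non-root vertices with [k] descendants. In the
    induction, a new leaf contributes [phi 1], and a subtree of size [s] grows with probability
    [s / n.+1]; [psi] is the resulting mean. *)
Lemma avg_sum_subtree_size n (phi : nat -> R) :
  avg n (fun h => \sum_(2 <= c < n.+2) phi (subtree_size h c)) =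
  \sum_(1 <= k < n.+1) n.+1%:R / (k%:R * k.+1%:R) * phi k.
Proof.
elim: n phi => [|n IH] phi; first by rewrite /= !big_geq.
pose psi s := (s%:R * phi s.+1 + (n.+1%:R - s%:R) * phi s) / n.+1%:R.
have n0 : n.+1%:R != 0 :> R by rewrite pnatr_eq0.
transitivity (avg n (fun h => phi 1%N + \sum_(2 <= c < n.+2) psi (subtree_size h c))).
  rewrite [LHS]/=; apply: eq_avg => h vh sh.
  rewrite (eq_big_nat _ _ (F2 := fun i => phi 1%N + \sum_(2 <= c < n.+2)
     (if anc h c i then phi (subtree_size h c).+1 else phi (subtree_size h c)))).
    rewrite big_split sumr_const_nat subSS subn0 /= exchange_big /=.
    rewrite -[phi 1%N *+ _]mulr_natl mulrDr mulKf // mulr_sumr; congr (_ + _).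
    by apply: eq_bigr => c _; rewrite -sh sum_anc /psi sh; field.
  move=> i hi; rewrite big_nat_recr //= addrC.
  rewrite -[in X in subtree_size _ X.+2]sh subtree_size_new; last first.
    by rewrite /= vh andbT sh; lia.
  congr (_ + _); apply: eq_big_nat => c hc; rewrite subtree_size_cons ?sh; last lia.
  by case: anc; rewrite ?addn1 ?addn0.
rewrite avgD avg_cst IH.
have kn0 k : k.+1%:R != 0 :> R by rewrite pnatr_eq0.
(* The terms in [phi k.+1] are shifted by one, with [phi 1] filling the first place; the second sum
   gains only a zero term at [k = n.+1]. *)
transitivity (\sum_(1 <= k < n.+2) phi k / k%:R +
  \sum_(1 <= k < n.+2) (n.+1%:R - k%:R) / (k%:R * k.+1%:R) * phi k).
  rewrite [X in _ = X + _]big_ltn // mulr1n divr1 -addrA; congr (_ + _).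
  rewrite big_add1 /= [X in _ = _ + X]big_nat_recr //= subrr !mul0r addr0.
  rewrite -big_split; apply: eq_big_nat => -[//|k] _; rewrite /psi.
  by rewrite /=; field; rewrite !nat1r -natrD !pnatr_eq0.
rewrite -big_split; apply: eq_big_nat => -[//|k] _ /=.
by field; rewrite !nat1r -natrD !pnatr_eq0.
Qed.

End Average.

(** * Probability of being as central as the root *)

Section Bounds.
Variable R : realFieldType.

(* If [p] is the limit proportion of the second colour in a Polya urn with
   [a] and [b] balls, then [b / (a + b)] is the mean of [p] and
   [b (b + 1) / ((a + b) (a + b + 1))] is the mean of [p ^ 2]. The two
   potentials are [4 E p^2] and the positive part of [2 E p^2 - E p]. *)
Definition upper_potential (a b : nat) : R :=
  4 * (b%:R * b.+1%:R) / ((a + b)%:R * (a + b).+1%:R).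

Definition lower_potential (a b : nat) : R :=
  if (b < a)%N then 0
  else b%:R * (b.+1%:R - a%:R) / ((a + b)%:R * (a + b).+1%:R).

Lemma upper_potential_ge0 a b : 0 <= upper_potential a b.
Proof. by rewrite /upper_potential divr_ge0 ?mulr_ge0. Qed.

(** The factor 4 serves here: [a + b <= 2 b] and [a + b + 1 <= 2 (b + 1)]. *)
Lemma upper_potential_ge1 a b : (a <= b)%N -> (0 < b)%N -> 1 <= upper_potential a b.
Proof.
move=> ab b0; rewrite /upper_potential ler_pdivlMr ?mul1r ?mulr_gt0 ?ltr0n //; last lia.
by rewrite -!natrM ler_nat; nia.
Qed.

Lemma upper_potential_superharmonic : urn_superharmonic upper_potential.
Proof.
move=> a b a0 b0; rewrite /upper_potential.
have ? : a%:R > 0 :> R by rewrite ltr0n.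
have ? : b%:R > 0 :> R by rewrite ltr0n.
(* Equality holds, the potential being a multiple of a martingale. *)
rewrite le_eqVlt; apply/orP; left; apply/eqP.
by field; rewrite !lt0r_neq0 //; lra.
Qed.

Lemma lower_potential_ge0 a b : 0 <= lower_potential a b.
Proof.
rewrite /lower_potential; case: ltnP => // ab.
by rewrite divr_ge0 ?mulr_ge0 ?subr_ge0 ?ler_nat // leqW.
Qed.

Lemma lower_potential_le a b : lower_potential a b <= (a <= b)%N%:R.
Proof.
rewrite /lower_potential; case: (ltnP b a) => [//|ab].
case: b ab => [|b] ab; first by rewrite !mul0r.
rewrite ler_pdivrMr ?mul1r ?mulr_gt0 ?ltr0n //; last lia.
rewrite -natrB; last lia.
by rewrite -!natrM ler_nat; nia.
Qed.

(** The positive part of the martingale [f] is a submartingale; the minus sign turns this into an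
    instance of [urn_superharmonic]. *)
Lemma lower_potential_subharmonic :
  urn_superharmonic (fun a b => - lower_potential a b).
Proof.
pose f a b : R := b%:R * (b.+1%:R - a%:R) / ((a + b)%:R * (a + b).+1%:R).
have le_f a b : f a b <= lower_potential a b.
  rewrite /lower_potential; case: ltnP => // ba.
  by rewrite /f mulr_le0_ge0 ?invr_ge0 // mulr_ge0_le0 // subr_le0 ler_nat.
move=> a b a0 b0.
have [A0 B0] : a%:R > 0 :> R /\ b%:R > 0 :> R by rewrite !ltr0n.
rewrite !mulrN -opprD lerN2.
case: (ltnP b a) => ba.
  by rewrite {1}/lower_potential ba mulr0 addr_ge0 ?mulr_ge0 ?lower_potential_ge0.
have -> : (a + b)%:R * lower_potential a b = a%:R * f a.+1 b + b%:R * f a b.+1.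
  rewrite /lower_potential ltnNge ba /= /f.
  by field; rewrite !lt0r_neq0 //; lra.
by rewrite lerD // ler_wpM2l.
Qed.

(** A union bound: [large_pair_nested] provides an ancestor [c'] of [v] whose urn satisfies
    [a <= b], and its term alone is at least 1. *)
Lemma as_central_le_urn h v : valid h -> (2 <= v <= (size h).+1)%N ->
  (as_central_as_root h v)%:R <=
  \sum_(2 <= c < v.+1) urn upper_potential c v h.
Proof.
move=> vh hv.
have ge0 c : 0 <= urn upper_potential c v h.
  by rewrite /urn; case: ifP => // _; apply: upper_potential_ge0.
case: (boolP (as_central_as_root h v)) => [/hasP[c]|_]; last exact: sumr_ge0.
rewrite mem_iota => cS big.
have [|||c' c'v /andP[cv' big']] := @large_pair_nested h c v vh _ _ _ big; try lia.
rewrite (bigD1_seq c') ?mem_index_iota ?iota_uniq //=.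
rewrite -[leLHS]addr0 lerD ?sumr_ge0 //.
rewrite /urn cv' upper_potential_ge1 //; first lia.
by apply: subtree_size_gt0; lia.
Qed.

Lemma urn_le_as_central h v : valid h -> (0 < size h)%N ->
  urn lower_potential 2 v h <= (as_central_as_root h v)%:R.
Proof.
move=> vh h0; rewrite /urn; case: ifP => // a2v.
apply: (le_trans (lower_potential_le _ _)).
rewrite ler_nat; case: (leqP _ (subtree_size h v)) => // le.
suff -> : as_central_as_root h v by [].
by apply/hasP; exists 2%N; rewrite ?mem_iota; lia.
Qed.

(** Put [K = k] and [J = n + 1 - k]. Writing [J + K + 2] as [(J + 1) + (K + 1)] splits its product
    with the summand into [1 / ((K + 1) (J + 2))], at most [1 / (n + 1)], and a telescoping
    difference. *)
Lemma sum_reciprocal_le (n : nat) :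
  \sum_(1 <= k < n.+1) ((k.+1%:R * ((n.+1 - k).+1%:R * (n.+1 - k).+2%:R))^-1 : R)
  <= 2 / n.+1%:R.
Proof.
pose g (k : nat) : R := (n.+1%:R - k%:R + 2)^-1.
have n0 : 0 < n.+1%:R :> R by rewrite ltr0n.
apply: (@le_trans _ _ (\sum_(1 <= k < n.+1)
   (n.+1%:R^-1 + (g k.+1 - g k)) / n.+1%:R)).
  rewrite big_nat [leRHS]big_nat; apply: ler_sum => k hk.
  rewrite ler_pdivlMr // /g; set j := (n.+1 - k)%N.
  have -> : n.+1%:R = j%:R + k%:R :> R by rewrite -natrD; congr (_%:R); lia.
  have k1 : 1 <= k%:R :> R by rewrite ler1n; lia.
  have -> : k.+1%:R = k%:R + 1 :> R by rewrite natr1.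
  have [-> ->] : j.+1%:R = j%:R + 1 :> R /\ j.+2%:R = j%:R + 2 :> R.
    by rewrite natr1 -natrD addn2.
  move: (ler0n R j) k1; move: (j%:R) (k%:R) => J K J0 K1.
  set T := _^-1.
  have T0 : 0 <= T by rewrite invr_ge0 !mulr_ge0 //; lra.
  have TE : T * (J + K + 2) = ((K + 1) * (J + 2))^-1 + ((J + 1)^-1 - (J + 2)^-1).
    by rewrite /T; field; rewrite !lt0r_neq0 //; lra.
  have : ((K + 1) * (J + 2))^-1 <= (J + K)^-1.
    by rewrite lef_pV2 ?posrE ?mulr_gt0 //; [nra|lra..].
  rewrite (_ : J + K - (K + 1) + 2 = J + 1); last by ring.
  rewrite (_ : J + K - K + 2 = J + 2); last by ring.
  nra.
rewrite -mulr_suml ler_pM2r ?invr_gt0 // big_split /= telescope_sumr //.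
rewrite sumr_const_nat subn1 /= /g subrr add0r -[_ *+ _]mulr_natl.
have : n%:R / n.+1%:R <= 1 :> R by rewrite ler_pdivrMr // mul1r ler_nat.
have : 0 <= (n.+1%:R - 1%:R + 2)^-1 :> R by rewrite invr_ge0 -natrB // addr_ge0.
have : 2^-1 <= 1 :> R by lra.
by move: (_ / _) ((_ - _ + _)^-1) => x y; lra.
Qed.

Lemma upper_potential1 a :
  upper_potential a 1 = 8 / (a.+1%:R * a.+2%:R).
Proof. by rewrite /upper_potential addn1; congr (_ / _); ring. Qed.

Lemma avg_as_central_le n v : (2 <= v <= n.+1)%N ->
  avg n (fun h => (as_central_as_root h v)%:R) <= 24 / v.-1%:R :> R.
Proof.
case: v => [|[|m]] // hv.
apply: (@le_trans _ _ (\sum_(2 <= c < m.+3) avg n (urn upper_potential c m.+2))).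
  rewrite -avg_sum; apply: avg_le => h vh sh; apply: as_central_le_urn => //; lia.
(* The supermartingale property moves each urn back to the time when [v = m.+2] is inserted. *)
apply: (@le_trans _ _ (\sum_(2 <= c < m.+3) avg m.+1 (urn upper_potential c m.+2))).
  rewrite big_nat [leRHS]big_nat; apply: ler_sum => c hc.
  rewrite -(subnK (_ : m.+1 <= n)%N); last lia.
  by apply: avg_urn_le; [exact: upper_potential_superharmonic|lia|lia].
rewrite big_nat_recr //= -[X in _ + X]/(avg m.+1 _) avg_urn_birth_refl.
rewrite (eq_big_nat _ _ (F2 := fun c => m.+1%:R^-1 * avg m (fun h =>
    (subtree_size h c)%:R * upper_potential (m.+1 - subtree_size h c) 1)));
  last by move=> c hc; apply: avg_urn_birth.
rewrite -mulr_sumr -avg_sum.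
rewrite (avg_sum_subtree_size m (fun s => s%:R * upper_potential (m.+1 - s) 1)).
have m0 : 0 < m.+1%:R :> R by rewrite ltr0n.
rewrite mulr_sumr (eq_big_nat _ _ (F2 := fun k => 8 * (k.+1%:R *
    ((m.+1 - k).+1%:R * (m.+1 - k).+2%:R))^-1)); last first.
  case=> // k hk; rewrite upper_potential1 -!natr1.
  move: (ler0n R (m.+1 - k.+1)) (ler0n R k) (ler0n R m).
  move: (_%:R) (k%:R) (m%:R) => J K M J0 K0 M0.
  by field; rewrite !lt0r_neq0 //; lra.
rewrite -mulr_sumr /= upper_potential1.
(* The constant is [24 = 8 * 2 + 8]: the sum over [c < v], then the term [c = v]. *)
have := sum_reciprocal_le m; set S := \sum_(_ <= _ < _) _ => S_le.
have : 8 / (m.+2%:R * m.+3%:R) <= 8 / m.+1%:R :> R.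
  rewrite ler_pM2l // lef_pV2 ?posrE ?mulr_gt0 ?ltr0n //.
  by rewrite -natrM ler_nat; nia.
by move: S_le; move: (_ / (_ * _)) m.+1%:R^-1 => x y; lra.
Qed.

(** At the insertion of [v = m.+3], keep only the case where all other non-root vertices descend
    from 2, of probability [1 / m.+1]. Then [v] joins them with probability [m.+1 / m.+2], and the
    urn starts at [(1, 1)], where the potential is [1 / 6]. *)
Lemma avg_as_central_ge n v : (3 <= v <= n.+1)%N ->
  (6 * v.-1%:R)^-1 <= avg n (fun h => (as_central_as_root h v)%:R) :> R.
Proof.
case: v => [|[|[|m]]] // hv.
apply: (@le_trans _ _ (avg n (urn lower_potential 2 m.+3))); last first.
  by apply: avg_le => h vh sh; apply: urn_le_as_central => //; lia.
apply: (@le_trans _ _ (avg m.+2 (urn lower_potential 2 m.+3))); last first.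
  have := @avg_urn_le R _ 2 m.+3 m.+2 (n - m.+2) lower_potential_subharmonic isT ltac:(lia).
  rewrite subnK; last lia.
  have urnN k : avg k (urn (fun a b => - lower_potential a b) 2 m.+3) =
      - avg k (urn lower_potential 2 m.+3).
    rewrite -mulN1r -avgZ; apply: eq_avg => h _ _.
    by rewrite /urn mulN1r; case: ifP; rewrite ?oppr0.
  by rewrite !urnN lerN2.
rewrite avg_urn_birth //.
have m0 : 0 < m.+1%:R :> R by rewrite ltr0n.
have m1 : 0 < m.+2%:R :> R by rewrite ltr0n.
have lp1 : lower_potential 1 1 = 6^-1.
  by rewrite /lower_potential /=; field.
(* Only [c = 2] can have [m.+1] descendants, so this probability is an entry of the expected subtree
   profile. *)
have avg2 : avg m.+1 (fun h => (subtree_size h 2 == m.+1)%:R) = m.+1%:R^-1 :> R.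
  transitivity (avg m.+1 (fun h => \sum_(2 <= c < m.+3)
      ((subtree_size h c == m.+1)%:R : R))).
    apply: eq_avg => h vh sh; rewrite big_ltn // big_nat big1 ?addr0 // => c hc.
    have /= := @subtree_size_bound h c vh ltac:(lia).
    by case: eqP => //; lia.
  rewrite (avg_sum_subtree_size m.+1 (fun s => (s == m.+1)%:R)) big_nat_recr //=.
  rewrite big_nat big1 => [|k hk]; last by rewrite ltn_eqF ?mulr0 //; lia.
  rewrite eqxx /=; field; rewrite !nat1r -?natrD !pnatr_eq0; lia.
apply: (@le_trans _ _ (m.+2%:R^-1 * avg m.+1 (fun h =>
    m.+1%:R / 6 * (subtree_size h 2 == m.+1)%:R))).
  rewrite avgZ avg2 /= le_eqVlt; apply/orP; left; apply/eqP.
  by field; rewrite !nat1r -?natrD !pnatr_eq0; lia.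
rewrite ler_pM2l ?invr_gt0 //; apply: avg_le => h vh sh.
case: eqP => [->|_]; last by rewrite mulr0 mulr_ge0 ?lower_potential_ge0.
by rewrite subSnn lp1 mulr1.
Qed.

End Bounds.

(** * Law of the random tree *)

Lemma sum_ltn_nat (R : pzSemiRingType) (m K : nat) : (m <= K)%N ->
  \sum_(0 <= j < K) ((j < m)%N%:R : R) = m%:R.
Proof.
move=> mK; rewrite (@big_cat_nat _ _ _ m) //= [X in _ + X]big_nat.
rewrite [X in _ + X]big1 => [|j]; last by case/andP=> mj _; rewrite ltnNge mj.
rewrite addr0 (eq_big_nat _ _ (F2 := fun=> 1)) => [|j /andP[_ ->]//].
by rewrite sumr_const_nat subn0.
Qed.

Section URRT.
Context (R : realType) (d : measure_display) (Omega : measurableType d)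
  (P : probability Omega R) (T : nat -> Omega -> graph).
Hypothesis T_URRT : uniform_random_recursive_tree P T.

Lemma URRT_history n w : exists h, [/\ valid h, size h = n & T n.+1 w = build h].
Proof.
have [T1 [xi Txi]] := T_URRT.
elim: n => [|n [h [vh sh Th]]]; first by exists [::]; rewrite T1.
have [/(_ w) xi_n /(_ w) ->] := Txi n.+1 isT.
by exists (xi n.+1 w :: h); rewrite /= sh vh Th andbT.
Qed.

(** Split on the last attachment vertex and apply induction to the preimage of [B] under [attach];
    measurability is carried along in the same induction. *)
Lemma URRT_law n (B : set graph) :
  measurable [set w | B (T n.+1 w)] /\
  P [set w | B (T n.+1 w)] = (avg n (fun h => `[< B (build h) >]%:R))%:E.
Proof.
have [T1 [xi Txi]] := T_URRT.
elim: n B => [|n IH] B.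
  have -> : [set w | B (T 1%N w)] = [set w | B root_tree].
    by apply/seteqP; split => w /=; rewrite T1.
  case: (pselect (B root_tree)) => Br /=.
    rewrite (_ : [set _ | _] = setT); last by apply/seteqP; split.
    by rewrite probability_setT asboolT.
  rewrite (_ : [set _ | _] = set0); last by apply/seteqP; split.
  by rewrite measure0 asboolF.
have [xi_n Tn xi_law indep] := Txi n.+1 isT.
pose F i := [set w | xi n.+1 w = i.+1] `&`
  [set w | B (attach (T n.+1 w) i.+1 n.+2)].
have -> : [set w | B (T n.+2 w)] = \big[setU/set0]_(i < n.+1) F i.
  rewrite -bigcup_mkord; apply/seteqP; split => w /=; rewrite Tn.
    move=> Bw; have := xi_n w => xw.
    exists (xi n.+1 w).-1; first by rewrite /=; lia.
    by rewrite /F /= prednK //; lia.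
  by move=> [i _ [/= -> ]].
have mF i : measurable (F i).
  apply: measurableI; last by apply: (IH (fun g => B (attach g i.+1 n.+2))).1.
  have -> : [set w | xi n.+1 w = i.+1] = xi n.+1 @^-1` [set i.+1] by [].
  by apply: measurable_funPTI.
have tF : trivIset setT F.
  by move=> i j _ _ [w [[/= xi1 _] [/= xi2 _]]]; apply: succn_inj; rewrite -xi1.
split; first exact: bigsetU_measurable.
rewrite measure_bigsetU // [RHS]/=.
transitivity (\sum_(i < n.+1) (n.+1%:R^-1 *
    avg n (fun h => `[< B (attach (build h) i.+1 n.+2) >]%:R : R))%:E)%E.
  apply: eq_bigr => i _; rewrite EFinM /F.
  rewrite -(IH (fun g => B (attach g i.+1 n.+2))).2 -(xi_law i.+1); last by have := ltn_ord i; lia.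
  (* [T n.+1] is the last entry of the past, so independence from the past applies. *)
  have -> : [set w | B (attach (T n.+1 w) i.+1 n.+2)] =
     [set w | B (attach (nth root_tree [seq T k w | k <- iota 1 n.+1] n) i.+1 n.+2)].
    by apply: eq_set => w; rewrite (nth_map 0%N) ?size_iota // nth_iota // add1n.
  exact: (indep [set i.+1] (fun p => B (attach (nth root_tree p n) i.+1 n.+2))).
rewrite sumEFin -mulr_sumr -avg_sum -avgZ; congr (_%:E); apply: eq_avg => h vh sh.
by rewrite big_add1 /= big_mkord sh.
Qed.

(** Layer-cake formula: [f] is the sum over [j < K] of the indicators of [j < f], whose means are
    given by [URRT_law]. *)
Lemma expectation_URRT n (f : graph -> nat) (K : nat) :
  (forall h, valid h -> size h = n -> (f (build h) <= K)%N) ->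
  'E_P[fun w => (f (T n.+1 w))%:R]%E = (avg n (fun h => (f (build h))%:R))%:E.
Proof.
move=> fK; rewrite unlock.
pose A j := [set w | (j < f (T n.+1 w))%N].
have mA j : measurable (A j) := (URRT_law n (fun g => (j < f g)%N)).1.
transitivity (\int[P]_w (\sum_(j <- index_iota 0 K) (\1_(A j) w)%:E))%E.
  apply: eq_integral => w _; rewrite sumEFin; congr (_%:E).
  have [h [vh sh Th]] := URRT_history n w.
  rewrite -(@sum_ltn_nat _ _ K); last by rewrite Th fK.
  apply: eq_bigr => j _; rewrite indicE; congr (nat_of_bool _)%:R.
  by apply/idP/idP; rewrite inE.
rewrite ge0_integral_sum //; last first.
  by move=> j; apply/measurable_EFinP/measurable_indic.
rewrite (eq_bigr (fun j => (avg n (fun h => (j < f (build h))%N%:R))%:E)).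
  rewrite sumEFin -avg_sum; congr (_%:E); apply: eq_avg => h vh sh.
  by rewrite sum_ltn_nat // fK.
move=> j _; rewrite integral_indic // setIT.
apply: (etrans (URRT_law n (fun g => (j < f g)%N)).2).
by congr (_%:E); apply: eq_avg => h _ _; rewrite asboolb.
Qed.

End URRT.

(** * Logarithmic growth *)

Lemma ln_le_harmonic (R : realType) n :
  ln n.+1%:R <= \sum_(1 <= k < n.+1) k%:R^-1 :> R.
Proof.
elim: n => [|n IH]; first by rewrite ln1 big_geq.
rewrite big_nat_recr //=.
have n0 : 0 < n.+1%:R :> R by rewrite ltr0n.
have -> : n.+2%:R = n.+1%:R * (1 + n.+1%:R^-1) :> R.
  by rewrite mulrDr mulr1 divff ?natr1 // lt0r_neq0.
rewrite lnM ?posrE ?addr_gt0 ?invr_gt0 //.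
by rewrite lerD // le_ln1Dx // (lt_trans _ (_ : 0 < _)) ?invr_gt0 // ltrN10.
Qed.

Lemma harmonic_le_ln (R : realType) n :
  \sum_(1 <= k < n.+2) k%:R^-1 <= 1 + ln n.+1%:R :> R.
Proof.
elim: n => [|n IH]; first by rewrite ln1 big_nat1 invr1 addr0.
rewrite big_nat_recr //=; apply: (le_trans (lerD IH (lexx _))).
have n0 : 0 < n.+2%:R :> R by rewrite ltr0n.
have n1 : 0 < n.+1%:R :> R by rewrite ltr0n.
have x1 : n.+2%:R^-1 < 1 :> R by rewrite invf_lt1 // ltr1n.
have : ln (1 + - n.+2%:R^-1) <= - n.+2%:R^-1 :> R by rewrite le_ln1Dx // ltrN2.
have -> : 1 + - n.+2%:R^-1 = n.+1%:R / n.+2%:R :> R.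
  by field; rewrite -natrD pnatr_eq0.
by rewrite ln_div ?posrE //; move: (ln _) (ln _) (_^-1) => x y z; lra.
Qed.

Lemma avg_jordan_rank (R : realFieldType) n :
  avg n (fun h => (jordan_rank (build h) 1%N)%:R) = 1 +
  \sum_(2 <= v < n.+2) avg n (fun h => (as_central_as_root h v)%:R) :> R.
Proof.
rewrite -avg_sum -[X in _ = X + _](avg_cst n) -avgD; apply: eq_avg => h vh sh.
by rewrite jordan_rank_root // sh -nat1r natr_sum.
Qed.

Theorem corollary10 (R : realType) (d : measure_display)
    (Omega : measurableType d) (P : probability Omega R)
    (T : nat -> Omega -> graph)
    (T_URRT : uniform_random_recursive_tree P T) :
  (fun n : nat => fine 'E_P[fun w => (jordan_rank (T n w) 1%N)%:R] : R^o)
    \is 'Theta_\oo (fun n : nat => ln n%:R : R^o).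
Proof.
(* The mean is at most [1 + 24 (1 + ln n)], and [ln n >= 1 / 2] turns the constant 25 into
   [50 ln n], whence 74. Below, [1 + (H - 1) / 6 >= ln n / 6]. *)
rewrite qualifE; apply/asboolP; exists (6^-1, 74); first by apply/andP; split => /=; lra.
near=> n; rewrite [(_, _).1]/= [(_, _).2]/=.
have n2 : (2 <= n)%N by near: n; exact: nbhs_infty_ge.
have [m ->] : exists m, n = m.+2 by exists n.-2; lia.
rewrite (expectation_URRT T_URRT (f := fun g => jordan_rank g 1%N) (K := m.+3)); last first.
  move=> h vh sh; rewrite jordan_rank_root // sh ltnS.
  apply: (@leq_trans (\sum_(2 <= v < m.+3) 1)).
    by apply: leq_sum => v _; case: as_central_as_root.
  by rewrite sum_nat_const_nat; lia.
rewrite [fine _](avg_jordan_rank R m.+1).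
set S := \sum_(_ <= _ < _) _.
have S_ge0 : 0 <= S.
  apply: sumr_ge0 => v _; rewrite -[leLHS](avg_cst m.+1).
  by apply: avg_le => h _ _.
pose H : R := \sum_(1 <= k < m.+2) k%:R^-1.
have S_le : S <= 24 * H.
  rewrite /S big_add1 succnK /H mulr_sumr big_nat [leRHS]big_nat.
  by apply: ler_sum => v hv; apply: avg_as_central_le; lia.
(* The lower bound starts at [v = 3]: the term [v = 2] is only bounded by 0, which costs the term
   [k = 1] of [H]. *)
have S_ge : 6^-1 * (H - 1) <= S.
  rewrite /S big_add1 succnK /H [X in X - 1]big_ltn // [X in _ <= X]big_ltn // invr1 addrAC subrr add0r.
  rewrite -[leLHS]add0r lerD //.
    by rewrite -[leLHS](avg_cst m.+1); apply: avg_le => h _ _.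
  rewrite mulr_sumr [leLHS]big_nat [leRHS]big_nat; apply: ler_sum => v hv.
  by rewrite -invfM; apply: (@avg_as_central_ge _ m.+1 v.+1); lia.
have H_ge : ln m.+2%:R <= H := ln_le_harmonic R m.+1.
have H_le : H <= 1 + ln m.+2%:R.
  apply: le_trans (harmonic_le_ln R m.+1).
  by rewrite [leRHS]big_nat_recr //= lerDl invr_ge0.
have ln_ge : 2^-1 <= ln m.+2%:R :> R.
  apply: (@le_trans _ _ (ln 2)); last by rewrite ler_ln ?posrE ?ltr0n // ler_nat.
  have := harmonic_le_ln R 1; rewrite big_nat_recr //= big_nat1 invr1; lra.
rewrite !ger0_norm; [|lra|lra].
by split; lra.
Unshelve. all: by end_near.
Qed.
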